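(* With $\beta=q+q^{-1}$, we have $$(A^* )^3A-(\beta+1)(A^* )^2AA^*+(\beta+1)A^*A(A^* )^2-A(A^* )^3=0.$$
   Context: Let $\mathbb F_q$ be a finite field with $q$ elements, let $N,M$ be positive integers, let $H$ be a vector space over $\mathbb F_q$ of dimension $N+M$, and fix a subspace $h\subseteq H$ of dimension $M$. Let $X$ be the set of subspaces $y\subseteq H$ with $y\cap h=0$, partially ordered by inclusion (the Attenuated Space poset $\mathcal A_q(N,M)$). For $y,z\in X$, $z$ covers $y$ when $y\subseteq z$ and $\dim z-\dim y=1$; $y,z$ are adjacent when one of them covers the other. Let $\mathrm{Mat}_X(\mathbb C)$ be the algebra of complex matrices with rows and columns indexed by $X$. The matrix $A\in\mathrm{Mat}_X(\mathbb C)$ has $(y,z)$-entry $1$ if $y$ covers $z$; $q^{\dim y}$ if $z$ covers $y$; and $0$ if $y,z$ are not adjacent. The matrix $A^*\in\mathrm{Mat}_X(\mathbb C)$ is diagonal with $(y,y)$-entry $q^{-\dim y}$ for $y\in X$. *)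

(* Defs.v *)
From HB Require Import structures.
From mathcomp Require Import all_boot all_order all_algebra.
From mathcomp Require Export reals complex.

Set Implicit Arguments.
Unset Strict Implicit.
Unset Printing Implicit Defensive.

Import GRing.Theory VectorInternalTheory.
Local Open Scope ring_scope.

(* Over a finite field there are finitely many subspaces: {vspace H} is a
   subtype of the square matrices. *)
HB.instance Definition _ (F : finFieldType) (H : vectType F) :=
  [Countable of {vspace H} by <:].
HB.instance Definition _ (F : finFieldType) (H : vectType F) :=
  [Finite of {vspace H} by <:].

(* The Attenuated Space poset X; the order is inclusion of the underlying
   subspaces. *)
Record attenuated (F : finFieldType) (H : vectType F) (h : {vspace H}) :=
  Attenuated {
    att_vspace :> {vspace H};
    att_vspaceP : (att_vspace :&: h == 0)%VS
  }.

HB.instance Definition _ (F : finFieldType) (H : vectType F) (h : {vspace H}) :=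
  [isSub for @att_vspace F H h].
HB.instance Definition _ (F : finFieldType) (H : vectType F) (h : {vspace H}) :=
  [Finite of attenuated h by <:].

Definition att_covers (F : finFieldType) (H : vectType F) (h : {vspace H})
    (z y : attenuated h) : bool :=
  (y <= z)%VS && (\dim z == (\dim y).+1).

(* Mat_X(C): MathComp matrices are indexed by ordinals, so the finite type X
   is identified with 'I_#|X| through its enumeration. *)
Definition mat_of (C : Type) (X : finType) (f : X -> X -> C) : 'M[C]_(#|X|) :=
  \matrix_(i, j) f (enum_val i) (enum_val j).

Section AttenuatedMatrices.

Variables (C : numClosedFieldType).
Variables (F : finFieldType) (H : vectType F) (h : {vspace H}).

Definition attA : 'M[C]_(#|{: attenuated h}|) :=
  mat_of (fun y z : attenuated h =>
    if att_covers y z then 1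
    else if att_covers z y then #|F|%:R ^+ \dim y
    else 0).

Definition attAstar : 'M[C]_(#|{: attenuated h}|) :=
  mat_of (fun y z : attenuated h =>
    if y == z then #|F|%:R ^- \dim y else 0).

End AttenuatedMatrices.

(* Main.v *)
Require Import Defs.
From HB Require Import structures.
From mathcomp Require Import all_boot all_order all_algebra ring.

Set Implicit Arguments.
Unset Strict Implicit.
Unset Printing Implicit Defensive.

Import GRing.Theory.
Local Open Scope ring_scope.

(* A* is diagonal, so the (y, z)-entry of the left-hand side is A(y, z) times
   a^3 - (beta + 1) a^2 b + (beta + 1) a b^2 - b^3
     = (a - b) (a - q b) (a - q^-1 b),
   with a and b the diagonal entries of A* at y and z. If A(y, z) is nonzero
   then the dimensions of y and z differ by one, so that b = q a or a = q b. *)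

Lemma attAstar_diag (C : numClosedFieldType) (F : finFieldType)
    (H : vectType F) (h : {vspace H}) :
  attAstar C h = diag_mx (\row_(j < #|{: attenuated h}|) #|F|%:R ^- \dim (enum_val j)).
Proof.
apply/matrixP=> i j; rewrite !mxE (inj_eq enum_val_inj).
by case: eqVneq => [->|_]; rewrite ?mulr1n ?mulr0n.
Qed.

Lemma attA_neq0 (C : numClosedFieldType) (F : finFieldType)
    (H : vectType F) (h : {vspace H}) (i j : 'I_#|{: attenuated h}|) :
  attA C h i j != 0 ->
  \dim (enum_val i) = (\dim (enum_val j)).+1 \/
  \dim (enum_val j) = (\dim (enum_val i)).+1.
Proof.
rewrite mxE; case: ifP => [/andP[_ /eqP->] _|_]; first by left.
by case: ifP => [/andP[_ /eqP->] _|_]; [right | rewrite eqxx].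
Qed.

(** A factor [D] on the left scales row [i] by [d 0 i], one on the right scales column [j] by
    [d 0 j]. *)
Lemma diag_mx_cubicE (R : comPzRingType) (n : nat) (d : 'rV[R]_n)
    (A : 'M[R]_n) (c : R) (i j : 'I_n) (D := diag_mx d) :
  (D ^+ 3 * A - c *: (D ^+ 2 * A * D) + c *: (D * A * D ^+ 2)
     - A * D ^+ 3) i j =
  (d 0 i ^+ 3 - c * (d 0 i ^+ 2 * d 0 j) + c * (d 0 i * d 0 j ^+ 2)
     - d 0 j ^+ 3) * A i j.
Proof.
(* Rebracket so that each [D] acts directly on a product containing [A]. *)
rewrite /D !exprS expr0 !mulr1 -!mulmxE !mulmxA -!(mulmxA (diag_mx d)).
rewrite !(mul_diag_mx, mul_mx_diag) !mxE; ring.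
Qed.

Theorem proposition8p7 (R : realType) (F : finFieldType) (N M : nat)
    (H : vectType F) (h : {vspace H})
    (N_gt0 : (0 < N)%N) (M_gt0 : (0 < M)%N)
    (dimH : \dim {: H} = (N + M)%N) (dimh : \dim h = M) :
  let q : R[i] := #|F|%:R in
  let beta : R[i] := q + q^-1 in
  let A := attA R[i] h in
  let As := attAstar R[i] h in
  As ^+ 3 * A - (beta + 1) *: (As ^+ 2 * A * As)
    + (beta + 1) *: (As * A * As ^+ 2) - A * As ^+ 3 = 0.
Proof.
move=> q beta A As.
have q0 : q != 0 by rewrite Num.Theory.pnatr_eq0 -lt0n; apply/card_gt0P; exists 0.
apply/matrixP=> i j; rewrite /As attAstar_diag diag_mx_cubicE [RHS]mxE.
have [->|/attA_neq0 dim_ij] := eqVneq (A i j) 0; first by rewrite mulr0.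
(* Row index [0] limits [mxE] to the diagonal vector, keeping [A i j] folded. *)
rewrite !(mxE _ _ 0) -/q.
suff -> : forall a b, a = q * b \/ b = q * a ->
    a ^+ 3 - (beta + 1) * (a ^+ 2 * b) + (beta + 1) * (a * b ^+ 2) - b ^+ 3 = 0.
- by rewrite mul0r.
(* The exponents are negative, so the subspace of larger dimension has the entry smaller by a factor
   [q]; hence the swapped order. *)
- case: dim_ij => ->; [right | left]; by rewrite exprS invfM mulVKf.
by move=> a b [] ->; rewrite /beta; field.
Qed.
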